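(* Let $A\in\mathbb{R}^{d\times d}$ be symmetric, $b\in\mathbb{R}^d$, $\rho\ge0$, and let $F(x)=\tfrac12x^TAx+b^Tx+\frac{\rho}{3}\|x\|^3$. Let $x^\star$ be a global minimizer of $F$ over $\mathbb{R}^d$, and for an integer $t\ge1$ let $s_t$ be a minimizer of $F$ over $\mathcal{K}_t(A,b)$. Then for every integer $t\ge1$, $$F(s_t)-F(x^\star)\le36\,\big[F(0)-F(x^\star)\big]\exp\left\{-4t\sqrt{\frac{\lambda_{\min}+\rho\|x^\star\|}{\lambda_{\max}+\rho\|x^\star\|}}\right\}$$ and $$F(s_t)-F(x^\star)\le\frac{(\lambda_{\max}-\lambda_{\min})\|x^\star\|^2}{(t-\frac12)^2}\left[4+\frac{\mathbb{1}_{\{\lambda_{\min}<0\}}}{8}\log^2\left(\frac{4\|b\|^2}{(u_{\min}^Tb)^2}\right)\right].$$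
   Context: $\|\cdot\|$ is the Euclidean norm. $\lambda_{\min}\le\lambda_{\max}$ are the smallest and largest eigenvalues of $A$, and $u_{\min}$ is a unit eigenvector of $A$ for $\lambda_{\min}$. The Krylov subspace of order $t$ is $\mathcal{K}_t(A,b)=\mathrm{span}\{b,Ab,\dots,A^{t-1}b\}$. $\mathbb{1}_{\{\lambda_{\min}<0\}}$ equals $1$ if $\lambda_{\min}<0$ and $0$ otherwise. When $\rho>0$ a global minimizer always exists; when $\rho=0$ the statement concerns the case where one exists. Conventions for degenerate cases: if $\lambda_{\max}+\rho\|x^\star\|=0$ (so also $\lambda_{\min}+\rho\|x^\star\|=0$) the ratio inside the exponential is read as $0$; if $\lambda_{\min}\ge0$ the logarithmic term is absent; if $\lambda_{\min}<0$ and $u_{\min}^Tb=0$ the right-hand side of the second bound is read as $+\infty$. *)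

(* Defs.v *)
From HB Require Import structures.
From mathcomp Require Import all_boot all_order all_algebra.
From mathcomp Require Import all_classical all_reals all_analysis.

Set Implicit Arguments.
Unset Strict Implicit.
Unset Printing Implicit Defensive.

Import Order.TTheory GRing.Theory Num.Theory.

Local Open Scope classical_set_scope.
Local Open Scope ring_scope.

Definition dot (R : realType) (d : nat) (x y : 'cV[R]_d) : R :=
  (x^T *m y) 0 0.

(* The library norm on matrices is the sup norm, hence a separate definition. *)
Definition enorm (R : realType) (d : nat) (x : 'cV[R]_d) : R :=
  Num.sqrt (dot x x).

Definition cubic (R : realType) (d : nat) (A : 'M[R]_d) (b : 'cV[R]_d)
    (rho : R) (x : 'cV[R]_d) : R :=
  1 / 2 * dot x (A *m x) + dot b x + rho / 3 * enorm x ^+ 3.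

Definition krylov (R : realType) (d : nat) (A : 'M[R]_d) (b : 'cV[R]_d)
    (t : nat) : {vspace 'cV[R]_d} :=
  <<[seq A ^+ i *m b | i <- iota 0 t]>>%VS.

Definition minimizer_on (R : realType) (T : Type) (f : T -> R) (S : set T)
    (x : T) : Prop :=
  S x /\ forall y, S y -> f x <= f y.

(* [eigenvalue] refers to row eigenvectors, but a square matrix has the same
   eigenvalues on either side. *)
Definition smallest_eigenvalue (R : realType) (d : nat) (A : 'M[R]_d)
    (l : R) : Prop :=
  eigenvalue A l /\ forall a, eigenvalue A a -> l <= a.

Definition largest_eigenvalue (R : realType) (d : nat) (A : 'M[R]_d)
    (l : R) : Prop :=
  eigenvalue A l /\ forall a, eigenvalue A a -> a <= l.

Definition unit_eigenvector (R : realType) (d : nat) (A : 'M[R]_d) (l : R)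
    (u : 'cV[R]_d) : Prop :=
  A *m u = l *: u /\ enorm u = 1.

(* [nx] stands for the norm of the global minimizer. As [y / 0 = 0], the ratio
   is 0 when its denominator vanishes. *)
Definition linear_rate (R : realType) (lmin lmax rho nx : R) (t : nat) : R :=
  expR (- (4 * t%:R * Num.sqrt ((lmin + rho * nx) / (lmax + rho * nx)))).

(* Extended-real valued, because the bound is void ([+oo]) when [lmin < 0] and
   [u] is orthogonal to [b]. When [0 <= lmin] the indicator removes the
   logarithmic term, whatever the value of the (total) function [ln] there. *)
Definition sublinear_bound (R : realType) (d : nat) (b u : 'cV[R]_d)
    (lmin lmax nx : R) (t : nat) : \bar R :=
  if (lmin < 0) && (dot u b == 0) then +oo%E
  else ((lmax - lmin) * nx ^+ 2 / (t%:R - 1 / 2) ^+ 2 *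
        (4 + (lmin < 0)%R%:R / 8 *
               ln (4 * enorm b ^+ 2 / dot u b ^+ 2) ^+ 2))%:E.

(* Main.v *)
Require Import Defs.
From mathcomp Require Import all_boot all_order all_algebra ring lra.
From mathcomp Require Import spectral sesquilinear complex.
From mathcomp Require Import all_classical all_reals all_analysis.

(* Write [x] for the global minimizer and [lam = rho |x|]. Optimality gives
   [(A + lam) x = - b] and [lmin + lam >= 0], so for a polynomial [p] of degree
   at most [t] with [p(- lam) = 1] the point [x - p(A) x] lies in the Krylov
   space, and by the spectral theorem quadratic forms in [p(A) x] are compared
   by comparing polynomials on [lmin, lmax].

   First bound: scaled Chebyshev polynomials give
   [|p| <= e = 2 exp(- 2 t sqrt(ratio))]. Either [3 e > 1] and [0] is a good
   enough candidate, or one rescales [x - p(A) x] to the norm of [x]; then the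
   gap is quadratic in the distance to [x], which is at most [3 e] relative to
   [x] in the [A + lam] norm, whence [36 = 4 * 9].

   Second bound: Fejer polynomials [0 <= p <= 1] give a candidate [y] in the ball
   of radius [|x|] which is good for the quadratic shifted by [- lmin]. If
   [lmin < 0], a Krylov vector [z] with Rayleigh quotient close to [lmin],
   obtained from Chebyshev polynomials of the third kind, moves [y] along
   [+z] or [-z] to the sphere, where shifted and original gaps agree. *)

Set Implicit Arguments.
Unset Strict Implicit.
Unset Printing Implicit Defensive.

Import Order.TTheory GRing.Theory Num.Theory.
Import numFieldNormedType.Exports.

Local Open Scope classical_set_scope.
Local Open Scope ring_scope.

(** * Euclidean inner product *)

Section Dot.
Variables (R : realType) (d : nat).
Implicit Types (x y z : 'cV[R]_d) (A : 'M[R]_d).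

Lemma dotE x y : dot x y = \sum_i x i 0 * y i 0.
Proof. by rewrite /dot mxE; apply: eq_bigr => i _; rewrite mxE. Qed.

Lemma dotC x y : dot x y = dot y x.
Proof. by rewrite !dotE; apply: eq_bigr => i _; rewrite mulrC. Qed.

Lemma dotDl x y z : dot (x + y) z = dot x z + dot y z.
Proof. by rewrite /dot linearD mulmxDl mxE. Qed.

Lemma dotZl a x y : dot (a *: x) y = a * dot x y.
Proof. by rewrite /dot linearZ -scalemxAl mxE. Qed.

Lemma dotNl x y : dot (- x) y = - dot x y.
Proof. by rewrite -scaleN1r dotZl mulN1r. Qed.

Lemma dotDr x y z : dot x (y + z) = dot x y + dot x z.
Proof. by rewrite dotC dotDl !(dotC x). Qed.

Lemma dotZr a x y : dot x (a *: y) = a * dot x y.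
Proof. by rewrite dotC dotZl dotC. Qed.

Lemma dotNr x y : dot x (- y) = - dot x y.
Proof. by rewrite dotC dotNl dotC. Qed.

Definition dot_lin := (dotDl, dotDr, dotNl, dotNr, dotZl, dotZr).

Lemma dot_mulmxr A x y : dot x (A *m y) = dot (A^T *m x) y.
Proof. by rewrite /dot trmx_mul trmxK mulmxA. Qed.

Lemma dot_ge0 x : 0 <= dot x x.
Proof. by rewrite dotE; apply: sumr_ge0 => i _; exact: sqr_ge0. Qed.

Lemma dot_eq0 x : (dot x x == 0) = (x == 0).
Proof.
apply/eqP/eqP => [|->]; last by rewrite -[0](scale0r 0) dotZl mul0r.
rewrite dotE => /eqP; rewrite psumr_eq0 => [/allP x0|i _]; last exact: sqr_ge0.
apply/matrixP => i j; rewrite ord1 mxE; apply/eqP.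
by have := x0 i (mem_index_enum i); rewrite /= mulf_eq0 orbb.
Qed.

Lemma dot_gt0 x : (0 < dot x x) = (x != 0).
Proof. by rewrite lt0r dot_eq0 dot_ge0 andbT. Qed.

Lemma enorm_ge0 x : 0 <= enorm x.
Proof. exact: sqrtr_ge0. Qed.

Lemma enorm_sqr x : enorm x ^+ 2 = dot x x.
Proof. exact/sqr_sqrtr/dot_ge0. Qed.

Lemma enorm_eq0 x : (enorm x == 0) = (x == 0).
Proof. by rewrite -sqrf_eq0 enorm_sqr dot_eq0. Qed.

Lemma enormZ a x : enorm (a *: x) = `|a| * enorm x.
Proof. by rewrite /enorm !dot_lin mulrA -expr2 sqrtrM ?sqr_ge0// sqrtr_sqr. Qed.

Lemma enorm_le x y : (enorm x <= enorm y) = (dot x x <= dot y y).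
Proof. by rewrite ler_psqrt // nnegrE dot_ge0. Qed.

Lemma dot_enorm x y : dot x y <= enorm x * enorm y.
Proof.
have [->|x0] := eqVneq x 0.
  by rewrite -[0](scale0r 0) dotZl mul0r mulr_ge0 ?enorm_ge0.
have [->|y0] := eqVneq y 0.
  by rewrite -[0](scale0r 0) dotZr mul0r mulr_ge0 ?enorm_ge0.
have X0 : 0 < enorm x by rewrite lt0r enorm_eq0 x0 enorm_ge0.
have Y0 : 0 < enorm y by rewrite lt0r enorm_eq0 y0 enorm_ge0.
(* Expanding this square gives Cauchy-Schwarz multiplied by [2 |x| |y|], which is positive here. *)
have := dot_ge0 (enorm x *: y - enorm y *: x).
rewrite !dot_lin (dotC y x) -!enorm_sqr.
move: (dot x y) (enorm x) (enorm y) X0 Y0 => D X Y X0 Y0 h.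
have XY : 0 < X * Y by rewrite mulr_gt0.
by rewrite -(ler_pM2l XY); lra.
Qed.

Lemma enormD x y : enorm (x + y) <= enorm x + enorm y.
Proof.
rewrite -(@ler_pXn2r _ 2) ?nnegrE ?addr_ge0 ?enorm_ge0//.
rewrite enorm_sqr !dot_lin (dotC y x) -!enorm_sqr.
by have := dot_enorm x y; nra.
Qed.

End Dot.

(** * Spectral theorem *)

Section Spectral.
Local Notation "M ^t*" := (map_mx Num.conj M^T) (at level 30).
Variables (R : realType) (n : nat) (A : 'M[R]_n.+1) (a b : R).
Hypothesis A_sym : A^T = A.
Hypothesis eigA : forall l, eigenvalue A l -> a <= l <= b.

(** Over the complex numbers [A] is Hermitian, hence unitarily diagonalizable with real eigenvalues;
    in these coordinates the form is a sum of terms [p(D_i) |y_i|^2]. *)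
Lemma dot_horner_mx_ge0 (p : {poly R}) (x : 'cV[R]_n.+1) :
  (forall l, a <= l <= b -> 0 <= p.[l]) -> 0 <= dot x (horner_mx A p *m x).
Proof.
move=> p_ge0.
pose f := real_complex R.
have conjf r : (f r)^* = f r by exact: conjc_real.
pose Ac := map_mx f A.
have hAc : Ac \is hermsymmx.
  apply/is_hermitianmxP; rewrite expr0 scale1r.
  by apply/matrixP => i j; rewrite !mxE conjf -[in LHS]A_sym mxE.
have /orthomx_spectralP := hermitian_normalmx hAc.
set P := spectralmx Ac; set D := spectral_diag Ac => AcE.
have Punit : P \in unitmx := spectral_unit Ac.
have PU : invmx P = P^t* by rewrite invmx_unitary ?spectral_unitarymx.
have Dp i : 0 <= (map_poly f p).[D 0 i].
  have /mxOverP/(_ 0 i)/complex_realP[l lE] := hermitian_spectral_diag_real hAc.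
  rewrite -/D in lE; rewrite lE (@horner_map _ _ f) ler0c; apply/p_ge0/eigA.
  (* Row [i] of [P] is a left eigenvector for [D 0 i], nonzero because [P] is invertible. *)
  have : eigenvalue Ac (D 0 i).
    apply/eigenvalueP; exists (row i P).
      rewrite AcE -row_mul !mulmxA mulmxV// mul1mx.
      apply/rowP => j; rewrite mul_diag_mx !mxE.
      by [].
    apply/eqP => /(congr1 (mulmx^~ (invmx P))).
    rewrite mul0mx -row_mul mulmxV // => /rowP/(_ i).
    by rewrite !mxE eqxx => /eqP; rewrite oner_eq0.
  by rewrite lE (eigenvalue_map f).
rewrite -ler0c -/(f _).
have hE : map_mx f (horner_mx A p) =
    P^t* *m diag_mx (map_mx (horner (map_poly f p)) D) *m P.
  by rewrite map_horner_mx -/Ac AcE -horner_mx_diag -PU horner_mx_uconjC.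
pose y := P *m map_mx f x.
have -> : f (dot x (horner_mx A p *m x)) =
   (y^t* *m diag_mx (map_mx (horner (map_poly f p)) D) *m y) 0 0.
  have -> : f (dot x (horner_mx A p *m x)) =
      map_mx f (x^T *m (horner_mx A p *m x)) 0 0 by rewrite [in RHS]mxE.
  have xE : (map_mx f x)^t* = map_mx f x^T.
    by apply/matrixP => i j; rewrite !mxE conjf.
  rewrite (map_mxM f) (map_mxM f) hE.
  rewrite /y trmx_mul map_mxM xE.
  by rewrite !mulmxA.
rewrite mul_mx_diag mxE; apply: sumr_ge0 => i _; rewrite !mxE.
by rewrite mulrAC mulr_ge0// -normCKC exprn_ge0.
Qed.

End Spectral.

(** * Chebyshev polynomials *)

Lemma nat_ind2 (P : nat -> Prop) :
  P 0%N -> P 1%N -> (forall n, P n -> P n.+1 -> P n.+2) -> forall n, P n.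
Proof.
move=> P0 P1 PS n; suff [] : P n /\ P n.+1 by [].
by elim: n => [//|n [Pn PSn]]; split=> //; exact: PS.
Qed.

(** One recurrence for three families. The ring is generic so that the same term denotes both a
    polynomial and its values, linked by [horner_cheb_rec]. *)
Fixpoint cheb_rec (R : pzRingType) (y c u0 u1 : R) (n : nat) : R :=
  if n is m.+1 then
    if m is k.+1 then 2 * y * cheb_rec y c u0 u1 m - cheb_rec y c u0 u1 k + c
    else u1
  else u0.

Lemma cheb_recSS (R : pzRingType) (y c u0 u1 : R) n :
  cheb_rec y c u0 u1 n.+2 =
  2 * y * cheb_rec y c u0 u1 n.+1 - cheb_rec y c u0 u1 n + c.
Proof. by []. Qed.

Lemma horner_cheb_rec (R : comNzRingType) (y c u0 u1 : {poly R}) n x :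
  (cheb_rec y c u0 u1 n).[x] = cheb_rec y.[x] c.[x] u0.[x] u1.[x] n.
Proof.
elim/nat_ind2: n => [//|//|n IH0 IH1].
by rewrite !cheb_recSS -!mulrA !mulr_natl !hornerE IH0 IH1.
Qed.

Lemma size_cheb_rec (R : nzRingType) (y c u0 u1 : {poly R}) n :
  (size y <= 2)%N -> (size c <= 1)%N -> (size u0 <= 1)%N -> (size u1 <= 2)%N ->
  (size (cheb_rec y c u0 u1 n) <= n.+1)%N.
Proof.
move=> ys cs s0 s1; elim/nat_ind2: n => [//|//|n IH0 IH1].
rewrite cheb_recSS (leq_trans (size_polyD _ _))// geq_max; apply/andP; split;
  last first.
  exact: leq_trans cs _.
rewrite (leq_trans (size_polyD _ _))// geq_max size_polyN; apply/andP; split;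
  last first.
  by rewrite (leq_trans IH0)// ltnW.
have size_yu : (size (y * cheb_rec y c u0 u1 n.+1)%R <= n.+3)%N.
  rewrite (leq_trans (size_polyMleq _ _))// -subn1 leq_subLR.
  exact: leq_add ys IH1.
by rewrite -mulrA mulr_natl mulr2n (leq_trans (size_polyD _ _))// geq_max size_yu.
Qed.

Section Cheb.
Variable R : realType.
Implicit Types (x y w m s X : R).

Definition chebT y n : R := cheb_rec y 0 1 y n.
(** Chebyshev polynomials of the third kind: [V_n(cos t) = cos((n + 1/2) t) / cos(t / 2)]. *)
Definition chebV y n : R := cheb_rec y 0 1 (2 * y - 1) n.
(* [fejer w n] is [(1 - T_(n.+1) (1 - 2 * w)) / (2 * w)]. *)
Definition fejer w n : R := cheb_rec (1 - 2 * w) 2 1 (4 - 4 * w) n.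

Lemma chebT_cos t n : chebT (cos t) n = cos (n%:R * t).
Proof.
elim/nat_ind2: n => [||n IH0 IH1].
- by rewrite mul0r cos0.
- by rewrite mul1r.
- rewrite /chebT cheb_recSS -!/(chebT _ _) IH0 IH1 addr0.
  have -> : n.+2%:R * t = n.+1%:R * t + t by rewrite -[n.+2]addn1 natrD; ring.
  have -> : n%:R * t = n.+1%:R * t - t by rewrite -[n.+1]addn1 natrD; ring.
  by rewrite cosB cosD; ring.
Qed.

Lemma chebT_le1 y n : -1 <= y <= 1 -> `|chebT y n| <= 1.
Proof.
move=> y1; rewrite -(acosK y1) chebT_cos ler_norml.
by rewrite cos_geN1 cos_le1.
Qed.

Lemma chebV_cos t n : chebV (cos (2 * t)) n * cos t = cos ((2 * n + 1)%:R * t).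
Proof.
have c2 : cos (2 * t) = 2 * cos t ^+ 2 - 1.
  by rewrite mulr_natl cos_mulr2n; ring.
elim/nat_ind2: n => [||n IH0 IH1].
- by rewrite /chebV/= !mul1r.
- have -> : (2 * 1 + 1)%:R * t = 2 * t + t by rewrite natrD; ring.
  rewrite /chebV/= cosD c2 [2 * t]mulr_natl sin_mulr2n.
  have := cos2Dsin2 t; set c := cos t; set s := sin t => cs.
  have -> : (c * s) *+ 2 * s = 2 * c * (s ^+ 2) by ring.
  have -> : s ^+ 2 = 1 - c ^+ 2 by rewrite -cs; ring.
  ring.
- rewrite /chebV cheb_recSS -!/(chebV _ _) addr0 mulrBl -mulrA IH0 IH1.
  have -> : (2 * n.+2 + 1)%:R * t = (2 * n.+1 + 1)%:R * t + 2 * t.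
    by rewrite !natrD !natrM -!(addn1 n.+1) -!(addn1 n) !natrD; ring.
  have -> : (2 * n + 1)%:R * t = (2 * n.+1 + 1)%:R * t - 2 * t.
    by rewrite !natrD !natrM -!(addn1 n) !natrD; ring.
  by rewrite cosB cosD; ring.
Qed.

(** With [y = cos (2 t)] the weight [(1 + y) / 2] is [cos t ^+ 2], so [chebV_cos] turns the left
    side into the square of a cosine. *)
Lemma chebV_le1 y n : -1 <= y <= 1 -> (1 + y) / 2 * chebV y n ^+ 2 <= 1.
Proof.
move=> y1; pose t := acos y / 2.
have -> : y = cos (2 * t) by rewrite /t mulrC divfK ?acosK// pnatr_eq0.
have -> : (1 + cos (2 * t)) / 2 = cos t ^+ 2.
  by rewrite [2 * t]mulr_natl cos_mulr2n; field.
rewrite -exprMn mulrC chebV_cos.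
set u := _ * t; by rewrite -(cos2Dsin2 u) lerDl sqr_ge0.
Qed.

Lemma fejer_chebT w n : 2 * w * fejer w n = 1 - chebT (1 - 2 * w) n.+1.
Proof.
elim/nat_ind2: n => [||n IH0 IH1].
- by rewrite /fejer/chebT/=; ring.
- by rewrite /fejer/chebT/=; ring.
- rewrite /fejer /chebT !(cheb_recSS _ _ _ _ n) (cheb_recSS _ _ _ _ n.+1).
  rewrite -!/(fejer _ _) -!/(chebT _ _).
  transitivity (2 * (1 - 2 * w) * (2 * w * fejer w n.+1) -
    2 * w * fejer w n + 4 * w).
    by ring.
  by rewrite IH0 IH1; ring.
Qed.

(** The left side consists of the terms of degree 0 and 1 in [m] of [fejer (- m) n]. The recurrence
    prescribes second differences, [4 m fejer + 2], so values and increments are compared in one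
    induction; the term linear in [m] is what later absorbs the factor [a + lam]. *)
Lemma fejer_ge m n (N := n.+1%:R : R) : 0 <= m ->
  N ^+ 2 + N ^+ 2 * (N ^+ 2 - 1) / 3 * m <= fejer (- m) n.
Proof.
move=> m0; rewrite {}/N.
pose e (N : R) := N ^+ 2 + N ^+ 2 * (N ^+ 2 - 1) / 3 * m.
suff [] : e n.+1%:R <= fejer (- m) n /\
  e n.+2%:R - e n.+1%:R <= fejer (- m) n.+1 - fejer (- m) n by [].
elim: n => [|n [IH0 IH1]]; first by rewrite /e /fejer/=; split; lra.
split; first by lra.
rewrite [fejer _ n.+2]cheb_recSS -!/(fejer _ _).
have IH2 : e n.+2%:R <= fejer (- m) n.+1 by lra.
have e_rec : e n.+3%:R - e n.+2%:R =
    e n.+2%:R - e n.+1%:R + 4 * m * n.+2%:R ^+ 2 + 2.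
  by rewrite /e -!(natr1 n.+2) -!(natr1 n.+1); field.
have : 4 * m * n.+2%:R ^+ 2 <= 4 * m * fejer (- m) n.+1.
  rewrite ler_wpM2l ?mulr_ge0//; apply: le_trans IH2.
  rewrite /e lerDl mulr_ge0// divr_ge0// mulr_ge0 ?sqr_ge0// subr_ge0.
  by rewrite exprn_ege1// ler1n.
move: IH1; rewrite e_rec; lra.
Qed.

(** Since [|T| <= 1], the product [2 w fejer] lies in [[0, 2]]. Hence the second differences
    [2 - 4 w fejer] are at most 2, which is the second difference of the squares. *)
Lemma fejer_bounds w n : 0 <= w <= 1 ->
  [/\ 0 <= fejer w n, fejer w n <= n.+1%:R ^+ 2 & w * fejer w n <= 1].
Proof.
move=> /andP[w0 w1].
have T1 k : `|chebT (1 - 2 * w) k| <= 1 by apply: chebT_le1; lra.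
have wf k : 0 <= w * fejer w k <= 1.
  have := fejer_chebT w k; move: (T1 k.+1); rewrite ler_norml; lra.
split; last by have /andP[] := wf n.
(* At [w = 0] one cannot divide by [w]; [fejer_ge] with [m = 0] takes over. *)
- have [->|wn0] := eqVneq w 0.
    have := @fejer_ge 0 n (lexx _); rewrite oppr0 mulr0 addr0.
    by apply: le_trans; exact: sqr_ge0.
  have /andP[+ _] := wf n; rewrite pmulr_rge0// lt0r wn0 w0//.
- suff [] : fejer w n <= n.+1%:R ^+ 2 /\
    fejer w n.+1 - fejer w n <= n.+2%:R ^+ 2 - n.+1%:R ^+ 2 by [].
  elim: n => [|n [IH0 IH1]]; first by rewrite /fejer/=; split; lra.
  split; first lra.
  rewrite [fejer _ n.+2]cheb_recSS -!/(fejer _ _).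
  have /andP[+ _] := wf n.+1; move: IH1.
  rewrite -!(natr1 n.+2) -!(natr1 n.+1); lra.
Qed.

(** Evaluates [chebT] outside [[-1, 1]], where it grows geometrically; [chebV_joukowski] does the
    same for [chebV]. *)
Lemma chebT_joukowski X n : X != 0 ->
  chebT ((X + X^-1) / 2) n = (X ^+ n + X^-1 ^+ n) / 2.
Proof.
move=> X0; have XZ := divff X0; move: (X^-1) XZ => Z XZ.
elim/nat_ind2: n => [||n IH0 IH1].
- by rewrite /chebT/= !expr0; field.
- by rewrite /chebT/= !expr1.
- rewrite /chebT cheb_recSS -!/(chebT _ _) IH0 IH1 !exprS.
  transitivity ((X * (X * X ^+ n) + Z * (Z * Z ^+ n)) / 2 +
     (X * Z - 1) * (X ^+ n + Z ^+ n) / 2); first by field.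
  by rewrite XZ subrr !mul0r addr0.
Qed.

Lemma chebV_joukowski X n : X != 0 ->
  chebV (- ((X + X^-1) / 2)) n * (X - 1) =
  (-1) ^+ n * (X ^+ n.+1 - X^-1 ^+ n).
Proof.
move=> X0; have XZ := divff X0; move: (X^-1) XZ => Z XZ.
elim/nat_ind2: n => [||n IH0 IH1].
- by rewrite /chebV/= expr1 !expr0 !mul1r.
- rewrite /chebV/= !expr1 expr2.
  transitivity (- (X * X - Z) + (1 - X * Z)); first by field.
  by rewrite XZ subrr addr0 mulN1r.
- rewrite /chebV cheb_recSS -!/(chebV _ _) addr0 mulrBl -mulrA IH0 IH1 !exprS.
  transitivity (-1 * (-1 * (-1) ^+ n) * (X * (X * (X * X ^+ n)) - Z * (Z * Z ^+ n))
    + (-1) ^+ n * (X * Z - 1) * (X * X ^+ n - Z ^+ n)); first by field.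
  by rewrite XZ subrr mulr0 mul0r addr0.
Qed.

(** This is [x <= artanh x] in exponential form. The function [g] vanishes at 0 and has derivative
    [y (exp y - exp (- y))], nonnegative for [y >= 0]. *)
Lemma expR_le_cayley x : 0 <= x < 1 -> expR (2 * x) <= (1 + x) / (1 - x).
Proof.
move=> /andP[x0 x1].
pose g (y : R) := (1 + y) * expR (- y) - (1 - y) * expR y.
have dg (y : R) : is_derive y 1 g (y * expR y - y * expR (- y)).
  by apply: is_derive_eq; rewrite -![_ *: _]/(_ * _); ring.
have g0 : 0 <= g x.
  have <- : g 0 = 0 by rewrite /g oppr0; ring.
  apply: (@ger0_derive1_ndecry _ g 0) => //.
  - move=> y; rewrite in_itv/= andbT => y0.
    rewrite derive1E derive_val -mulrBr mulr_ge0 ?(ltW y0)//.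
    by rewrite subr_ge0 ler_expR; lra.
  - apply: continuous_subspaceT => y.
    by apply/differentiable_continuous/derivable1_diffP.
rewrite ler_pdivlMr ?subr_gt0// mulrC.
have -> : 2 * x = x + x by ring.
rewrite expRD mulrA -ler_pdivlMr ?expR_gt0// -expRN.
by rewrite -subr_ge0.
Qed.

End Cheb.

(** * Extremal polynomials on an interval *)

Lemma size_affine_poly (R : nzRingType) (u v : R) : (size (u *: 'X + v%:P)%R <= 2)%N.
Proof.
rewrite (leq_trans (size_polyD _ _))// geq_max.
rewrite (leq_trans (size_scale_leq _ _)) ?size_polyX//.
by rewrite (leq_trans (size_polyC_leq1 _)).
Qed.

Lemma size_polyB_natl_leq (R : nzRingType) (p q : {poly R}) m n k :
  (size p <= k)%N -> (size q <= k)%N -> (size (m%:R * p - n%:R * q)%R <= k)%N.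
Proof.
move=> pk qk; rewrite (leq_trans (size_polyD _ _))// size_polyN geq_max.
by rewrite !mulr_natl -!scaler_nat !(leq_trans (size_scale_leq _ _)).
Qed.

Section Residual.
Variable R : realType.

(** Take [T_t] after the affine map [y] from [[a, b]] onto [[-1, 1]], divided by its value at
    [- lam]. That point goes to [Y > 1], whose Joukowski parameter is [X = (1 + x) / (1 - x)] with
    [x] the root of the ratio, so [T_t(Y) >= X^t / 2 >= exp(2 t x) / 2]. *)
Lemma exp_residual (a b lam : R) t : (1 <= t)%N -> a <= b -> 0 < a + lam ->
  exists2 p : {poly R}, (size p <= t.+1)%N /\ p.[- lam] = 1 &
    forall l, a <= l <= b ->
      `|p.[l]| <= 2 * expR (- (2 * t%:R * Num.sqrt ((a + lam) / (b + lam)))).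
Proof.
move=> t1 ab al; rewrite le_eqVlt in ab; case/predU1P: ab => [<-|ab].
  (* For a one-point interval, the affine polynomial that vanishes at [a] and equals 1 at
     [- lam]. *)
  exists (- (a + lam)^-1 *: 'X + (a / (a + lam))%:P) => [|l /le_anti <-].
    split; first by rewrite (leq_trans (size_affine_poly _ _)).
    by rewrite !hornerE; field; rewrite gt_eqF.
  have -> : (- (a + lam)^-1 *: 'X + (a / (a + lam))%:P).[a] = 0.
    by rewrite !hornerE; ring.
  by rewrite normr0 mulr_ge0// expR_ge0.
have [al0 bl0] : a + lam != 0 /\ b + lam != 0 by split; lra.
set x := Num.sqrt _.
have xE : x ^+ 2 = (a + lam) / (b + lam).
  by rewrite sqr_sqrtr// divr_ge0; lra.
have x0 : 0 <= x by exact: sqrtr_ge0.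
have x1 : x < 1.
  by rewrite -(@ltr_pXn2r _ 2)// ?nnegrE// expr1n xE ltr_pdivrMr; lra.
pose X := (1 + x) / (1 - x).
have X0 : X != 0 by rewrite mulf_neq0 ?invr_eq0; lra.
pose Y := (X + X^-1) / 2.
have YE : Y = (a + b + 2 * lam) / (b - a).
  have -> : Y = (1 + x ^+ 2) / (1 - x ^+ 2).
    rewrite /Y /X; field.
    have : x ^+ 2 < 1 by rewrite expr_lt1.
    by move=> ?; do ?[apply/andP; split]; lra.
  by rewrite xE; field; do ?[apply/andP; split]; lra.
have TY : expR (2 * t%:R * x) / 2 <= chebT Y t.
  rewrite chebT_joukowski// ler_pM2r ?invr_gt0//.
  have -> : expR (2 * t%:R * x) = expR (2 * x) ^+ t.
    by rewrite -expRM_natr; congr expR; ring.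
  rewrite -[leLHS]addr0 lerD//.
    by rewrite lerXn2r ?nnegrE ?expR_ge0 ?divr_ge0 ?expR_le_cayley ?x0//; lra.
  by rewrite exprn_ge0// invr_ge0 divr_ge0; lra.
have TY0 : 0 < chebT Y t by rewrite (lt_le_trans _ TY)// divr_gt0 ?expR_gt0.
pose y := (- (2 / (b - a))) *: 'X + ((a + b) / (b - a))%:P.
have yE l : y.[l] = (a + b - 2 * l) / (b - a).
  by rewrite !hornerE; field; lra.
have pE l : (cheb_rec y 0 1 y t).[l] = chebT y.[l] t.
  by rewrite horner_cheb_rec !hornerE.
exists ((chebT Y t)^-1 *: cheb_rec y 0 1 y t) => [|l /andP[la lb]].
  split.
    rewrite (leq_trans (size_scale_leq _ _))// size_cheb_rec ?size_affine_poly//.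
      by rewrite size_poly0.
    by rewrite size_poly1.
  rewrite hornerZ pE yE (_ : _ / _ = Y) ?mulVf ?gt_eqF//.
  by rewrite YE; congr (_ / _); ring.
rewrite hornerZ pE yE normrM normfV (gtr0_norm TY0) mulrC ler_pdivrMr//.
apply: (@le_trans _ _ 1).
  apply: chebT_le1; rewrite ler_pdivlMr ?ler_pdivrMr; lra.
rewrite expRN -ler_pdivrMl ?divr_gt0 ?expR_gt0// mulr1 invfM invrK mulrC//.
Qed.

(** The left side of the last inequality is the shifted gap of [x - p(A) x] at the eigenvalue [l].
    Here [p] is [fejer] after the affine map [w] from [[a, b]] onto [[0, 1]], divided by its value
    [D] at [- lam], which [w] sends to [- m]. *)
Lemma fejer_residual (a b lam : R) t : (1 <= t)%N -> a <= b -> 0 <= a + lam ->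
  exists2 p : {poly R}, (size p <= t.+1)%N /\ p.[- lam] = 1 &
    forall l, a <= l <= b -> 0 <= p.[l] <= 1 /\
      (l - a) / 2 * p.[l] ^+ 2 + (a + lam) * p.[l] <=
        4 * (b - a) / (t%:R - 1 / 2) ^+ 2.
Proof.
move=> t1 ab al.
have tR : 1 <= t%:R :> R by rewrite ler1n.
have B0 : 0 <= 4 * (b - a) / (t%:R - 1 / 2) ^+ 2.
  by rewrite divr_ge0 ?sqr_ge0//; lra.
rewrite le_eqVlt in ab; case/predU1P: ab => [ab|ab].
  (* If [- lam = a], then [p] is forced to be 1 on the one-point interval, but both terms to be
     bounded vanish there. *)
  have [al0|aln] := eqVneq (a + lam) 0.
    exists 1 => [|l]; first by rewrite size_poly1 hornerE.
    rewrite -ab in B0 * => /le_anti <-.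
    by rewrite al0 hornerE subrr !mul0r addr0 ler01 lexx mulr0 mul0r.
  exists (- (a + lam)^-1 *: 'X + (a / (a + lam))%:P) => [|l].
    split; first by rewrite (leq_trans (size_affine_poly _ _)).
    by rewrite !hornerE; field.
  rewrite -ab in B0 * => /le_anti <-.
  have -> : (- (a + lam)^-1 *: 'X + (a / (a + lam))%:P).[a] = 0.
    by rewrite !hornerE; ring.
  by rewrite lexx ler01 expr0n !mulr0 addr0.
pose L := b - a; pose m := (a + lam) / L.
have L0 : 0 < L by rewrite subr_gt0.
have m0 : 0 <= m by rewrite divr_ge0// ltW.
pose w : {poly R} := L^-1 *: 'X + (- (a / L))%:P.
have wE l : w.[l] = (l - a) / L by rewrite !hornerE; ring.
pose p := cheb_rec (1 - 2 * w) 2 1 (4 - 4 * w) t.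
have pE l : p.[l] = fejer w.[l] t.
  by rewrite horner_cheb_rec /fejer -(polyC_natr _ 2) -(polyC_natr _ 4) !hornerE.
have := fejer_ge t m0; set N := t.+1%:R; set D := fejer (- m) t => DN.
have NE : N = t%:R + 1 by rewrite /N natr1.
have NN : 1 <= N ^+ 2 by rewrite NE exprn_ege1//; lra.
have Nm : 0 <= N ^+ 2 * (N ^+ 2 - 1) / 3 * m.
  by rewrite mulr_ge0// divr_ge0// mulr_ge0; lra.
have D0 : 0 < D by lra.
exists (D^-1 *: p) => [|l /andP[la lb]].
  split.
    rewrite (leq_trans (size_scale_leq _ _))// size_cheb_rec//.
    - have := @size_polyB_natl_leq R 1 w 1 2 2; rewrite mul1r; apply.
        by rewrite size_poly1.
      exact: size_affine_poly.
    - by rewrite -(polyC_natr _ 2) size_polyC_leq1.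
    - by rewrite size_poly1.
    - have := @size_polyB_natl_leq R 1 w 4 4 2; rewrite mulr1; apply.
        by rewrite size_poly1.
      exact: size_affine_poly.
  rewrite hornerZ pE wE (_ : _ / _ = - m) ?mulVf ?gt_eqF//.
  by rewrite /m /L; field; lra.
have wl : 0 <= w.[l] <= 1.
  by rewrite wE divr_ge0 ?(ltW L0) ?ler_pdivrMr ?subr_ge0//= mul1r lerB.
have [f0 fN wf] := fejer_bounds t wl.
rewrite hornerZ pE; set f := fejer _ _ in f0 fN wf *.
have K0 : 0 < (t%:R - 1 / 2) ^+ 2 :> R by rewrite exprn_gt0//; lra.
have KN : (t%:R - 1 / 2) ^+ 2 <= N ^+ 2 - 1 by rewrite NE; nra.
move: ((t%:R - 1 / 2) ^+ 2) K0 KN {B0} => K K0 KN.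
have p01 : 0 <= D^-1 * f <= 1.
  by rewrite mulr_ge0 ?invr_ge0 ?(ltW D0)//= ler_pdivrMl//; lra.
split=> //; rewrite ler_pdivlMr// mulrDl.
have KD : 0 <= K / D <= 1.
  by rewrite divr_ge0 ?(ltW K0) ?(ltW D0)//= ler_pdivrMr// mul1r; lra.
have lf : (l - a) * f <= L.
  by move: wf; rewrite wE mulrAC ler_pdivrMr// mul1r.
(* One factor [f] is spent on [(l - a) f <= L]; the rest is [p <= 1] times [K / D <= 1]. *)
have h1 : (l - a) * (D^-1 * f) ^+ 2 * K <= L.
  rewrite (_ : _ * K = (l - a) * f * ((D^-1 * f) * (K / D))); last by ring.
  apply: le_trans lf; rewrite ler_piMr ?mulr_ge0 ?subr_ge0//.
  by case/andP: p01 => ? ?; case/andP: KD => ? ?; rewrite mulr_ile1.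
(* The part of [D] linear in [m] cancels [a + lam = L m], using [f <= N^2] and [K <= N^2 - 1]. With
   half of [h1] the total is [7/2 L], below [4 L]. *)
have h2 : (a + lam) * (D^-1 * f) * K <= 3 * L.
  have -> : a + lam = L * m by rewrite /m; field; lra.
  rewrite (_ : _ * K = L * (m * (f * K)) / D) ?ler_pdivrMr//; last by ring.
  have : m * (f * K) <= m * (N ^+ 2 * (N ^+ 2 - 1)).
    by rewrite ler_wpM2l// ler_pM// ltW.
  have -> : 3 * L * D = L * (3 * D) by ring.
  by rewrite (ler_pM2l L0); lra.
rewrite -/L; lra.
Qed.

(** Meant for [B = |b|^2] and [w = (u^T b)^2]: in the form of [A - a - sigma] at [g(A) b], the part
    of [b] along [u] contributes [- sigma g(a)^2 w] and the orthogonal part at most [M (B - w)]. The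
    last inequality makes the sum nonpositive. *)
Lemma lanczos_poly (a b B w : R) t (s := ln (4 * B / w) / (4 * (t%:R - 1 / 2)))
    (sigma := (b - a) * s ^+ 2) :
  (1 <= t)%N -> a <= b -> 0 < w <= B ->
  exists2 g : {poly R}, (size g <= t)%N /\ g.[a] != 0 &
    exists2 M : R, forall l, a <= l <= b -> (l - a - sigma) * g.[l] ^+ 2 <= M &
      M * (B - w) <= sigma * g.[a] ^+ 2 * w.
Proof.
move=> t1 ab /andP[w0 wB].
have tR : 1 <= t%:R :> R by rewrite ler1n.
have L0 : 0 <= b - a by rewrite subr_ge0.
have Bw : 1 <= B / w by rewrite ler_pdivlMr ?mul1r.
have sg0 : 0 <= sigma by rewrite mulr_ge0 ?sqr_ge0.
(* When [sigma] covers the whole interval, [g = 1] and [M = 0] suffice. *)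
have [Lsg|sgL] := leP (b - a) sigma.
  exists 1; first by rewrite size_poly1 hornerE oner_neq0.
  exists 0 => [l /andP[la lb]|]; rewrite -[1]/(1%:P) hornerC expr1n mulr1.
    by lra.
  by rewrite mul0r mulr_ge0// ltW.
have {}L0 : 0 < b - a by exact: le_lt_trans sgL.
have s0 : 0 < s.
  by rewrite divr_gt0 ?ln_gt0 -?mulrA; lra.
have s1 : s < 1.
  rewrite -(@ltr_pXn2r _ 2)// ?nnegrE ?(ltW s0)// expr1n.
  by rewrite -(ltr_pM2l L0) mulr1.
pose X := (1 + s) / (1 - s).
have X1 : 1 < X by rewrite ltr_pdivlMr; lra.
have X0 : 0 < X by lra.
pose Y := (X + X^-1) / 2.
have s2 : s ^+ 2 < 1 by rewrite expr_lt1// (ltW s0).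
have YE : Y = (1 + s ^+ 2) / (1 - s ^+ 2).
  by rewrite /Y /X; field; do ?[apply/andP; split]; lra.
(* The affine map from [[a + sigma, b]] onto [[-1, 1]]; then [(1 + y) / 2] is
   [(l - a - sigma) / (b - a - sigma)], the weight in [chebV_le1]. *)
pose y := (2 / (b - a - sigma)) *: 'X +
          (- ((2 * a + (b - a) + sigma) / (b - a - sigma)))%:P.
have yE l : y.[l] = (2 * (l - a) - (b - a) - sigma) / (b - a - sigma).
  rewrite hornerD hornerZ hornerX hornerC; field; lra.
have ya : y.[a] = - Y.
  by rewrite yE YE /sigma; field; do ?[apply/andP; split]; nra.
have y_size : (size y <= 2)%N by exact: size_affine_poly.
clearbody y.
pose g := cheb_rec y 0 1 (2 * y - 1) t.-1.
have gE l : g.[l] = chebV y.[l] t.-1.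
  rewrite horner_cheb_rec horner0 hornerD hornerN hornerM.
  by rewrite -(polyC_natr _ 2) -polyC1 !hornerC.
have gX : g.[a] ^+ 2 * (X - 1) ^+ 2 = (X ^+ t - X^-1 ^+ t.-1) ^+ 2.
  rewrite -exprMn gE ya chebV_joukowski ?gt_eqF// prednK//.
  by rewrite exprMn sqrr_sign mul1r.
have Xt : X^-1 ^+ t.-1 < X ^+ t.
  rewrite (@le_lt_trans _ _ 1)//.
    by rewrite exprn_ile1 ?invr_ge0 ?invf_le1 ?(ltW X0) ?(ltW X1).
  by rewrite exprn_egt1// -lt0n.
exists g.
  split.
    rewrite -[leqRHS]prednK//; apply: size_cheb_rec.
    - by [].
    - by rewrite size_poly0.
    - by rewrite size_poly1.
    - have := @size_polyB_natl_leq R y 1 2 1 2; rewrite mul1r; apply.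
        by [].
      by rewrite size_poly1.
  apply/eqP => ga; move: gX; rewrite ga expr0n mul0r => /esym/eqP.
  by rewrite sqrf_eq0 subr_eq0 gt_eqF.
exists (b - a - sigma) => [l /andP[la lb]|].
  have [ls|sl] := leP (l - a) sigma.
    by rewrite (@le_trans _ _ 0)// ?mulr_le0_ge0 ?sqr_ge0//; lra.
  rewrite gE -[leRHS]mulr1.
  rewrite (_ : l - a - sigma = (b - a - sigma) * ((1 + y.[l]) / 2)); last first.
    by rewrite yE; field; lra.
  rewrite -mulrA ler_wpM2l//; first by lra.
  by apply: chebV_le1; rewrite yE ler_pdivlMr ?ler_pdivrMr; lra.
have sX : sigma * (4 * X) = (b - a - sigma) * (X - 1) ^+ 2.
  by rewrite /sigma /X; field; lra.
have X10 : 0 < (X - 1) ^+ 2 by rewrite exprn_gt0// subr_gt0.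
rewrite -(ler_pM2l X10) (_ : (X - 1) ^+ 2 * _ = sigma * (4 * X * (B - w)));
  last first.
  by rewrite [RHS]mulrA sX; ring.
rewrite (_ : (X - 1) ^+ 2 * _ = sigma * (g.[a] ^+ 2 * (X - 1) ^+ 2 * w));
  last by ring.
rewrite gX ler_wpM2l//.
(* It remains to bound this square below by [4 X (B - w) / w]. Its leading term is
   [X * X^(2 t - 1)], and [s] is chosen so that [exp(2 s)^(2 t - 1) = 4 B / w]. *)
have XnE : X * (X ^+ t * X ^+ t.-1) - 2 * X <= (X ^+ t - X^-1 ^+ t.-1) ^+ 2.
  have pq : X ^+ t.-1 * X^-1 ^+ t.-1 = 1.
    by rewrite -exprMn divff ?expr1n// gt_eqF.
  rewrite -(prednK t1) exprS /=.
  rewrite (_ : (_ - _) ^+ 2 = X * (X * X ^+ t.-1 * X ^+ t.-1) -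
    2 * X * (X ^+ t.-1 * X^-1 ^+ t.-1) + X^-1 ^+ t.-1 ^+ 2); last by ring.
  by rewrite pq mulr1 lerDl sqr_ge0.
have XB : 4 * B / w <= X ^+ t * X ^+ t.-1.
  have <- : expR (2 * s) ^+ (t + t.-1) = 4 * B / w.
    rewrite -expRM_natr -[RHS]lnK; last by rewrite posrE -mulrA; lra.
    congr expR.
    have -> : (t + t.-1)%:R = 2 * t%:R - 1 :> R.
      by rewrite -[in RHS](prednK t1) natrD -[in LHS](prednK t1) -natr1; ring.
    by rewrite /s; field; lra.
  rewrite -exprD lerXn2r ?nnegrE ?expR_ge0 ?(ltW X0)//.
  by rewrite expR_le_cayley// (ltW s0).
apply: (@le_trans _ _ (X * (4 * B / w - 2) * w)).
  have -> : X * (4 * B / w - 2) * w = X * (4 * B - 2 * w) by field; lra.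
  have -> : 4 * X * (B - w) = X * (4 * B - 4 * w) by ring.
  by rewrite ler_pM2l//; lra.
rewrite ler_wpM2r ?(ltW w0)//; apply: le_trans XnE.
by rewrite mulrBr [X * 2]mulrC lerD2r ler_pM2l.
Qed.

End Residual.

(** * Optimality conditions *)

Section Optimality.
Variables (R : realType) (d : nat) (A : 'M[R]_d) (b : 'cV[R]_d) (rho : R).
Hypotheses (A_sym : A^T = A) (rho_ge0 : 0 <= rho).
Implicit Types x h u : 'cV[R]_d.

Lemma dot_mulmxC x h : dot x (A *m h) = dot h (A *m x).
Proof. by rewrite dot_mulmxr A_sym dotC. Qed.

(* From [N^3 - r^3 <= 3/2 N (N^2 - r^2)], i.e. [(N - r)^2 (N + 2 r) >= 0]. *)
Lemma cubic_shift_le x h :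
  cubic A b rho (x + h) - cubic A b rho x <=
    1 / 2 * dot h (A *m h) + dot h (A *m x + b) +
    rho / 2 * enorm (x + h) * (2 * dot x h + dot h h).
Proof.
rewrite /cubic mulmxDr !dot_lin (dot_mulmxC x h) (dotC b h).
have N2 := enorm_sqr (x + h); rewrite !dot_lin (dotC h x) -(enorm_sqr x) in N2.
have -> : 2 * dot x h + dot h h = enorm (x + h) ^+ 2 - enorm x ^+ 2.
  by rewrite N2; ring.
have := enorm_ge0 (x + h); have := enorm_ge0 x.
move: (enorm (x + h)) (enorm x) => N r r0 N0.
have : 0 <= rho * ((N - r) ^+ 2 * (N + 2 * r)).
  by rewrite mulr_ge0// mulr_ge0 ?sqr_ge0//; lra.
lra.
Qed.

Variable x : 'cV[R]_d.
Hypothesis x_min : minimizer_on (cubic A b rho) setT x.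

Let x_le h : 0 <= 1 / 2 * dot h (A *m h) + dot h (A *m x + b) +
    rho / 2 * enorm (x + h) * (2 * dot x h + dot h h).
Proof.
apply: le_trans (cubic_shift_le x h); rewrite subr_ge0.
by case: x_min => _; apply.
Qed.

(** No derivative of the norm is taken: a step [- e g] along the expected gradient [g] gives
    [|g|^2 <= e K] for all [e] in [(0, 1]], with [K] independent of [e]. *)
Lemma minimizer_stationary : A *m x + b + (rho * enorm x) *: x = 0.
Proof.
have [g gE] : exists g, g = A *m x + b + (rho * enorm x) *: x by eexists.
rewrite -gE; apply/eqP; rewrite -dot_eq0; apply/eqP/le_anti.
rewrite dot_ge0 andbT.
have [v vE] : exists v, v = - g by exists (- g).
pose K := `|dot v (A *m v)| + rho * enorm v * `|dot x v| +
  rho * (enorm x + enorm v) * dot v v.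
have K0 : 0 <= K.
  by rewrite !addr_ge0 ?mulr_ge0 ?addr_ge0 ?enorm_ge0 ?dot_ge0.
have gK e : 0 < e <= 1 -> dot g g <= e * K.
  move=> /andP[e0 e1].
  have := x_le (e *: v); rewrite -scalemxAr !dot_lin.
  have dvg : dot v (A *m x) + dot v b = - dot g g - rho * enorm x * dot x v.
    have -> : rho * enorm x * dot x v = dot v ((rho * enorm x) *: x).
      by rewrite dotZr (dotC v).
    by apply/eqP; rewrite eq_sym subr_eq -!dotDr -gE vE dotNl.
  have {}dvg : dot v b = - dot g g - rho * enorm x * dot x v - dot v (A *m x).
    by rewrite -dvg addrC addKr.
  rewrite dvg.
  have Nle : enorm (x + e *: v) <= enorm x + e * enorm v.
    by apply: le_trans (enormD _ _) _; rewrite enormZ (gtr0_norm e0).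
  have Nge : enorm x <= enorm (x + e *: v) + e * enorm v.
    have := enormD (x + e *: v) (- e *: v).
    by rewrite enormZ normrN (gtr0_norm e0) scaleNr addrK.
  have := enorm_ge0 (x + e *: v); move: (enorm (x + e *: v)) Nle Nge.
  move=> N Nle Nge N0 h.
  have vv0 := dot_ge0 v; have V0 := enorm_ge0 v.
  (* After the first-order terms cancel, the norm is still taken at the moved point; it differs from
     [|x|] by at most [e |v|]. *)
  have Nr : (N - enorm x) * dot x v <= e * (enorm v * `|dot x v|).
    apply: le_trans (ler_norm _) _; rewrite normrM mulrA ler_wpM2r//.
    by rewrite ler_norml; lra.
  have NV : N * dot v v <= (enorm x + enorm v) * dot v v.
    by rewrite ler_wpM2r//; nra.
  have vAv := ler_norm (dot v (A *m v)).
  rewrite -(ler_pM2l e0).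
  have e20 := sqr_ge0 e.
  have h1 := ler_wpM2l (ltW e0) (ler_wpM2l rho_ge0 Nr).
  have h2 := ler_wpM2l e20 (ler_wpM2l rho_ge0 NV).
  have h3 := ler_wpM2l e20 vAv.
  have h4 : 0 <= e ^+ 2 * `|dot v (A *m v)| by rewrite mulr_ge0.
  have h5 : 0 <= e ^+ 2 * (rho * ((enorm x + enorm v) * dot v v)).
    have rV : 0 <= enorm x + enorm v by rewrite addr_ge0 ?enorm_ge0.
    by rewrite mulr_ge0// mulr_ge0// mulr_ge0.
  rewrite /K; lra.
apply/ler_addgt0Pr => e e0; rewrite add0r.
have [eK|Ke] := leP e (K + 1).
  have eK1 : 0 < e / (K + 1) <= 1.
    by rewrite divr_gt0 ?ler_pdivrMr ?mul1r//; lra.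
  apply: le_trans (gK _ eK1) _; rewrite mulrAC ler_pdivrMr; last lra.
  by rewrite ler_pM2l//; lra.
by apply: le_trans (gK 1 _) _; rewrite ?ltr01 ?lexx// mul1r; lra.
Qed.

(** If [x] is not orthogonal to [u], reflecting [x] in the hyperplane orthogonal to [u] preserves
    the norm and changes the objective by [2 (x^T u)^2 (l + rho |x|)]. Otherwise small steps along
    [u] give the inequality in the limit. *)
Lemma minimizer_curvature l u : unit_eigenvector A l u ->
  0 <= l + rho * enorm x.
Proof.
move=> [Au u1].
have uu : dot u u = 1 by rewrite -enorm_sqr u1 expr1n.
have grad h : dot h (A *m x + b) = - (rho * enorm x * dot x h).
  rewrite (dotC x h) -dotZr -dotNr; congr dot.
  by apply/eqP; rewrite -addr_eq0 minimizer_stationary.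
have [xu|xu] := eqVneq (dot x u) 0.
  have rho1 : 0 < rho + 1 by exact: ltr_wpDl.
  apply/ler_addgt0Pr => e e0.
  (* The added 1 keeps the denominator positive when [rho = 0]. *)
  pose e' : R := e / (rho + 1).
  have e'0 : 0 < e' by rewrite divr_gt0.
  have := x_le (e' *: u); rewrite grad -scalemxAr Au !dot_lin xu uu.
  have : enorm (x + e' *: u) <= enorm x + e'.
    by apply: le_trans (enormD _ _) _; rewrite enormZ u1 mulr1 (gtr0_norm e'0).
  move: (enorm (x + _)) => N Ne h.
  have e2 : 0 < e' ^+ 2 by rewrite exprn_gt0.
  have lN : 0 <= l + rho * N by rewrite -(pmulr_rge0 _ e2); lra.
  have : rho * N <= rho * (enorm x + e') by rewrite ler_wpM2l.
  have : rho * e' <= e by rewrite /e' mulrCA ler_piMr ?(ltW e0) ?ler_pdivrMr//; lra.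
  lra.
have := x_le ((- 2 * dot x u) *: u).
have -> : enorm (x + (- 2 * dot x u) *: u) = enorm x.
  by rewrite /enorm !dot_lin uu (dotC u x); congr Num.sqrt; ring.
rewrite grad -scalemxAr Au !dot_lin uu => h.
have x2 : 0 < dot x u ^+ 2 by rewrite lt0r sqrf_eq0 xu sqr_ge0.
by rewrite -(pmulr_rge0 _ x2); lra.
Qed.

End Optimality.

(** * Krylov candidates *)

(** Up to the sign of [z], [al] is the nonnegative root of [|y + al z|^2 = r^2]. The step has length
    at most [2 r] since both ends lie in the ball of radius [r]. *)
Lemma boundary_step (R : realType) d (y z v : 'cV[R]_d) (r : R) :
  enorm y <= r -> z != 0 ->
  exists al, [/\ enorm (y + al *: z) = r, al * dot z v <= 0 &
                 al ^+ 2 * dot z z <= 4 * r ^+ 2].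
Proof.
move=> yr; wlog zv : z / dot z v <= 0 => [hw|] z0.
  have [/hw|vz] := leP (dot z v) 0; first exact.
  have [||al [h1 h2 h3]] := hw (- z); first by rewrite dotNl oppr_le0 ltW.
    by rewrite oppr_eq0.
  exists (- al); split; first by rewrite scaleNr -scalerN.
    by move: h2; rewrite dotNl mulrN mulNr.
  by move: h3; rewrite dotNl dotNr opprK sqrrN.
have zz : 0 < dot z z by rewrite dot_gt0.
have r0 : 0 <= r := le_trans (enorm_ge0 y) yr.
have yyr : dot y y <= r ^+ 2.
  by rewrite -enorm_sqr lerXn2r// nnegrE enorm_ge0.
pose D := dot y z ^+ 2 + dot z z * (r ^+ 2 - dot y y).
have D0 : 0 <= D by rewrite addr_ge0 ?sqr_ge0// mulr_ge0 ?subr_ge0// ltW.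
pose al := (Num.sqrt D - dot y z) / dot z z.
have al0 : 0 <= al.
  rewrite divr_ge0 ?(ltW zz)// subr_ge0 (le_trans (ler_norm _))//.
  by rewrite -sqrtr_sqr ler_sqrt// lerDl mulr_ge0 ?subr_ge0// ltW.
have alE : dot y y + 2 * al * dot y z + al ^+ 2 * dot z z = r ^+ 2.
  have s2 : Num.sqrt D ^+ 2 = D := sqr_sqrtr D0.
  rewrite /al; move: s2; rewrite /D; move: (Num.sqrt _) => s s2.
  apply: (mulIf (lt0r_neq0 zz)); transitivity
     (s ^+ 2 - dot y z ^+ 2 + dot z z * dot y y).
    by field; rewrite gt_eqF.
  by rewrite s2; ring.
exists al; split.
- rewrite /enorm -[RHS](ger0_norm r0) -sqrtr_sqr -alE !dot_lin (dotC z y).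
  by congr Num.sqrt; ring.
- by rewrite mulr_ge0_le0.
- have := dot_ge0 (2 *: y + al *: z); rewrite !dot_lin (dotC z y).
  lra.
Qed.

(** * Polynomials in [A] and Krylov vectors *)

Section FunctionalCalculus.
Variables (R : realType) (n : nat) (A : 'M[R]_n.+1) (lmin lmax : R).
Hypothesis A_sym : A^T = A.
Hypothesis eigA : forall l, eigenvalue A l -> lmin <= l <= lmax.
Implicit Types (p q : {poly R}) (x b u : 'cV[R]_n.+1).

Lemma trmx_horner_mx p : (horner_mx A p)^T = horner_mx A p.
Proof.
elim/poly_ind: p => [|p c IH]; first by rewrite rmorph0 trmx0.
rewrite rmorphD rmorphM /= horner_mx_X horner_mx_C linearD /= tr_scalar_mx.
rewrite -mulmxE trmx_mul IH A_sym; congr (_ + _).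
exact/comm_mx_horner/comm_mx_refl.
Qed.

Lemma dot_horner_mx2 p q x :
  dot (horner_mx A p *m x) (horner_mx A q *m x) =
  dot x (horner_mx A (p * q) *m x).
Proof.
by rewrite -[in LHS](trmx_horner_mx p) -dot_mulmxr mulmxA rmorphM.
Qed.

Lemma dot_horner_mx_le p q x : (forall l, lmin <= l <= lmax -> p.[l] <= q.[l]) ->
  dot x (horner_mx A p *m x) <= dot x (horner_mx A q *m x).
Proof.
move=> pq; rewrite -subr_ge0 -dotNr -dotDr -mulmxBl -rmorphB.
apply: (dot_horner_mx_ge0 A_sym eigA) => l /pq.
by rewrite hornerD hornerN subr_ge0.
Qed.

Lemma horner_mx_eigenvector p l u : A *m u = l *: u ->
  horner_mx A p *m u = p.[l] *: u.
Proof.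
move=> Au; elim/poly_ind: p => [|p c IH].
  by rewrite rmorph0 mul0mx horner0 scale0r.
rewrite rmorphD rmorphM /= horner_mx_X horner_mx_C mulmxDl -mulmxA Au.
by rewrite -scalemxAr IH mul_scalar_mx hornerMXaddC scalerA mulrC -scalerDl.
Qed.

Lemma horner_mx_1B p x : horner_mx A (1 - p) *m x = x - horner_mx A p *m x.
Proof.
by rewrite rmorphB -[1]/(1%:P) /= horner_mx_C mulmxBl mul_scalar_mx scale1r.
Qed.

Lemma horner_mx_CM c p x : horner_mx A (c%:P * p) *m x = c *: (horner_mx A p *m x).
Proof. by rewrite rmorphM /= horner_mx_C -mulmxE -mulmxA mul_scalar_mx. Qed.

Lemma horner_mx_XsubCM c p x : horner_mx A (('X - c%:P) * p) *m x =
  A *m (horner_mx A p *m x) - c *: (horner_mx A p *m x).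
Proof.
rewrite rmorphM rmorphB /= horner_mx_X horner_mx_C -mulmxE -mulmxA.
by rewrite mulmxBl mul_scalar_mx.
Qed.

Lemma mem_krylov p b t : (size p <= t)%N -> horner_mx A p *m b \in krylov A b t.
Proof.
move=> pt; rewrite -(coefK p) poly_def rmorph_sum mulmx_suml.
apply: memv_suml => i _; rewrite /= horner_mxZ -scalemxAl; apply: memvZ.
rewrite rmorphXn /= horner_mx_X; apply: memv_span; apply/mapP.
exists (i : nat) => //.
by rewrite mem_iota add0n (leq_trans (ltn_ord i)).
Qed.

(** As [1 - p] vanishes at [- lam], it factors as [r ('X + lam)], and [(A + lam) x = - b]; the
    factorization lowers the degree by one. *)
Lemma mem_krylov_residual p x b t lam : A *m x + b + lam *: x = 0 ->
  (size p <= t.+1)%N -> p.[- lam] = 1 ->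
  x - horner_mx A p *m x \in krylov A b t.
Proof.
move=> xb pt p1.
have /factor_theorem[r rE]: root (1 - p) (- lam).
  by rewrite /root hornerD hornerN -[1]/(1%:P) hornerC p1 subrr.
have -> : x - horner_mx A p *m x = horner_mx A (- r) *m b.
  have bE : b = - (A *m x + lam *: x).
    by apply/eqP; rewrite -addr_eq0 addrCA addrA xb.
  rewrite -horner_mx_1B rE.
  rewrite rmorphM rmorphB /= horner_mx_X horner_mx_C bE -mulmxE -mulmxA.
  rewrite [in RHS]rmorphN.
  by rewrite mulmxBl mul_scalar_mx scaleNr opprK mulNmx mulmxN opprK.
apply: mem_krylov; rewrite size_polyN.
have [->|r0] := eqVneq r 0; first by rewrite size_poly0.
have sr : size (r * ('X - (- lam)%:P)) = (size r).+1.
  by rewrite size_Mmonic ?monicXsubC// size_XsubC addn2.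
rewrite -ltnS -sr -rE.
rewrite (leq_trans (size_polyD _ _))// geq_max size_poly1 size_polyN.
by rewrite (leq_trans pt).
Qed.

(** Apply [lanczos_poly] to [b = (u^T b) u + b'] with [b'] orthogonal to [u]; cross terms vanish
    because [u] is an eigenvector of every polynomial in [A]. *)
Lemma approx_eigenvector u b t
    (s := ln (4 * dot b b / dot u b ^+ 2) / (4 * (t%:R - 1 / 2))) :
  (1 <= t)%N -> lmin <= lmax -> unit_eigenvector A lmin u -> dot u b != 0 ->
  exists z, [/\ z \in krylov A b t, z != 0 &
    dot z (A *m z - lmin *: z) <= (lmax - lmin) * s ^+ 2 * dot z z].
Proof.
move=> t1 ll [Au u1] ub; set sigma := _ * s ^+ 2.
have uu : dot u u = 1 by rewrite -enorm_sqr u1 expr1n.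
pose b' := b - dot u b *: u.
have ub' : dot u b' = 0 by rewrite !dot_lin uu mulr1 subrr.
have bE : b = dot u b *: u + b' by rewrite addrC subrK.
have bb : dot b b = dot u b ^+ 2 + dot b' b'.
  rewrite {1 2}bE; move: b' ub' {bE} => c uc.
  by rewrite !dot_lin (dotC c u) uc uu; ring.
have w0 : 0 < dot u b ^+ 2 by rewrite lt0r sqrf_eq0 ub sqr_ge0.
have wB : 0 < dot u b ^+ 2 <= dot b b by rewrite w0 bb lerDl dot_ge0.
have [g [gt ga] [M gM Mle]] := lanczos_poly t1 ll wB.
rewrite -/s -/sigma in gM Mle.
exists (horner_mx A g *m b); split; first exact: mem_krylov.
  (* The component along [u] is [g(lmin) (u^T b)], a product of nonzero factors. *)
  have : dot u (horner_mx A g *m b) != 0.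
    rewrite dot_mulmxr trmx_horner_mx (horner_mx_eigenvector _ Au) dotZl.
    by rewrite mulf_neq0.
  by apply: contraNneq => ->; rewrite -[0](scale0r 0) dotZr mul0r.
rewrite -subr_le0.
pose P := ('X - (lmin + sigma)%:P) * g ^+ 2.
have -> : dot (horner_mx A g *m b) (A *m (horner_mx A g *m b) -
    lmin *: (horner_mx A g *m b)) -
    sigma * dot (horner_mx A g *m b) (horner_mx A g *m b) =
    dot b (horner_mx A P *m b).
  rewrite -dotZr -dotNr -dotDr.
  have -> : A *m (horner_mx A g *m b) - lmin *: (horner_mx A g *m b) -
      sigma *: (horner_mx A g *m b) =
      horner_mx A (('X - (lmin + sigma)%:P) * g) *m b.
    by rewrite horner_mx_XsubCM scalerDl opprD addrA.
  by rewrite dot_horner_mx2 mulrCA.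
have PE l : P.[l] = (l - lmin - sigma) * g.[l] ^+ 2.
  by rewrite hornerM hornerXsubC horner_exp; ring.
have P_le : dot b' (horner_mx A P *m b') <= M * dot b' b'.
  rewrite -[M * _]dotZr -mul_scalar_mx -(horner_mx_C A).
  by apply: dot_horner_mx_le => l ll'; rewrite PE hornerC gM.
rewrite [X in dot X]bE [X in _ *m X]bE mulmxDr -scalemxAr.
rewrite (horner_mx_eigenvector _ Au) PE subrr sub0r.
move: b' ub' bb P_le {bE} => c uc bb P_le.
rewrite !dot_lin (dotC c u) uc uu.
have -> : dot u (horner_mx A P *m c) = 0.
  by rewrite dot_mulmxr trmx_horner_mx (horner_mx_eigenvector _ Au) dotZl uc mulr0.
have cE : dot c c = dot b b - dot u b ^+ 2 by rewrite bb addrC addKr.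
move: P_le Mle; rewrite cE; lra.
Qed.

End FunctionalCalculus.

(** * Objective gaps of Krylov candidates *)

Section Gap.
Variables (R : realType) (n : nat) (A : 'M[R]_n.+1) (b : 'cV[R]_n.+1).
Variables (rho lmin lmax : R) (x : 'cV[R]_n.+1).
Hypothesis A_sym : A^T = A.
Hypothesis eigA : forall l, eigenvalue A l -> lmin <= l <= lmax.
Hypothesis rho_ge0 : 0 <= rho.
Local Notation lam := (rho * enorm x).
Hypothesis x_stat : A *m x + b + lam *: x = 0.
Hypothesis lam_ge0 : 0 <= lmin + lam.
Hypothesis lmin_le : lmin <= lmax.

Lemma cubic_gap y : cubic A b rho y - cubic A b rho x =
  1 / 2 * dot (y - x) (A *m (y - x)) - lam * dot x (y - x) +
  rho / 3 * (enorm y ^+ 3 - enorm x ^+ 3).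
Proof.
have [h ->] : exists h, y = x + h by exists (y - x); rewrite addrC subrK.
rewrite {2 3 4}[x + h]addrC addrK.
have -> : lam * dot x h = - dot h (A *m x + b).
  rewrite -dotNr (dotC x) -dotZr; congr dot.
  by apply/eqP; rewrite -addr_eq0 addrC x_stat.
rewrite /cubic mulmxDr !dot_lin (dot_mulmxC A_sym x h) (dotC b h).
by field.
Qed.

(** Converts an error relative to [x] in the [A + lam] norm into one relative to the initial gap;
    the slack is [rho |x|^3 / 6]. *)
Lemma cubic0_gap : 1 / 2 * (dot x (A *m x) + lam * dot x x) <=
  cubic A b rho 0 - cubic A b rho x.
Proof.
rewrite cubic_gap sub0r mulmxN !dot_lin opprK.
have -> : enorm (0 : 'cV[R]_n.+1) = 0 by apply/eqP; rewrite enorm_eq0.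
have : 0 <= rho * enorm x ^+ 3 by rewrite mulr_ge0 ?exprn_ge0 ?enorm_ge0.
rewrite -enorm_sqr; lra.
Qed.

Lemma linear_candidate (t : nat) : (1 <= t)%N -> 0 < lmin + lam ->
  let e := 2 * expR (- (2 * t%:R * Num.sqrt ((lmin + lam) / (lmax + lam)))) in
  3 * e <= 1 ->
  exists2 y, y \in krylov A b t & cubic A b rho y - cubic A b rho x <=
    9 * e ^+ 2 * (1 / 2 * (dot x (A *m x) + lam * dot x x)).
Proof.
move=> t1 l0 e e1.
have [p [pt p1] pe] := exp_residual t1 lmin_le l0; rewrite -/e in pe.
have e0 : 0 < e by rewrite mulr_gt0// expR_gt0.
pose y := x - horner_mx A p *m x.
have yE : y = horner_mx A (1 - p) *m x.
  by rewrite horner_mx_1B.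
have yK : y \in krylov A b t by exact: mem_krylov_residual x_stat pt p1.
clearbody y.
have pE l : (1 - p).[l] = 1 - p.[l] by rewrite hornerD hornerN -[1]/(1%:P) hornerC.
have dotCx c : c * dot x x = dot x (horner_mx A c%:P *m x).
  by rewrite horner_mx_C mul_scalar_mx dotZr.
have yle : enorm y <= (1 + e) * enorm x.
  have -> : (1 + e) * enorm x = enorm ((1 + e) *: x).
    by rewrite enormZ ger0_norm//; lra.
  rewrite enorm_le !dot_lin mulrA dotCx yE (dot_horner_mx2 A_sym).
  apply: (dot_horner_mx_le A_sym eigA) => l /pe.
  rewrite hornerM pE hornerC ler_norml.
  nra.
have yge : (1 - e) * enorm x <= enorm y.
  have -> : (1 - e) * enorm x = enorm ((1 - e) *: x).
    by rewrite enormZ ger0_norm//; lra.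
  rewrite enorm_le !dot_lin mulrA dotCx yE (dot_horner_mx2 A_sym).
  apply: (dot_horner_mx_le A_sym eigA) => l /pe.
  rewrite hornerM pE hornerC ler_norml.
  nra.
(* For [x = 0] there is no norm to rescale to, but the candidate 0 is exact. *)
have [x0|x0] := eqVneq x 0.
  exists 0; first exact: mem0v.
  have d0 : dot (0 : 'cV[R]_n.+1) 0 = 0 by apply/eqP; rewrite dot_eq0.
  by rewrite x0 subrr mulmx0 d0 !mulr0 addr0 !mulr0.
have nx0 : 0 < enorm x by rewrite lt0r enorm_eq0 x0 enorm_ge0.
have ny0 : 0 < enorm y by apply: lt_le_trans yge; rewrite mulr_gt0//; lra.
pose c := enorm x / enorm y.
have c0 : 0 < c by rewrite divr_gt0.
have cy : enorm (c *: y) = enorm x by rewrite enormZ gtr0_norm// divfK ?gt_eqF.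
have cle : c * (1 - e) <= 1.
  by rewrite /c mulrAC ler_pdivrMr// mul1r mulrC.
have cge : 1 <= c * (1 + e).
  by rewrite /c mulrAC ler_pdivlMr// mul1r mulrC.
exists (c *: y).
  exact: memvZ.
pose f : {poly R} := c%:P * (1 - p) - 1.
have fE : c *: y - x = horner_mx A f *m x.
  have -> : f = - (1 - c%:P * (1 - p)) by rewrite opprB.
  rewrite rmorphN mulNmx horner_mx_1B rmorphM /= horner_mx_C.
  by rewrite -mulmxE -mulmxA -yE mul_scalar_mx opprB.
have -> : cubic A b rho (c *: y) - cubic A b rho x =
    1 / 2 * dot x (horner_mx A (f ^+ 2 * ('X + lam%:P)) *m x).
  have -> : dot x (horner_mx A (f ^+ 2 * ('X + lam%:P)) *m x) =
      dot (c *: y - x) (A *m (c *: y - x)) + lam * dot (c *: y - x) (c *: y - x).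
    rewrite expr2 -mulrA -dot_horner_mx2// -fE -dotZr -dotDr; congr dot.
    rewrite mulrC rmorphM rmorphD /= horner_mx_X horner_mx_C -mulmxE -mulmxA -fE.
    by rewrite mulmxDl mul_scalar_mx.
  rewrite cubic_gap cy subrr mulr0 addr0.
  (* Equal norms give [|v - x|^2 = - 2 x^T (v - x)] for [v = c y], so the linear term becomes
     quadratic. *)
  have := enorm_sqr (c *: y); rewrite cy enorm_sqr.
  move: (c *: y) => v; rewrite !dot_lin (dotC v x) => vv.
  by rewrite -vv; field.
have -> : 9 * e ^+ 2 * (1 / 2 * (dot x (A *m x) + lam * dot x x)) =
    1 / 2 * dot x (horner_mx A ((9 * e ^+ 2)%:P * ('X + lam%:P)) *m x).
  rewrite rmorphM rmorphD /= horner_mx_X !horner_mx_C -mulmxE -mulmxA mulmxDl.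
  by rewrite !mul_scalar_mx !dot_lin; ring.
rewrite ler_pM2l ?divr_gt0//; apply: (dot_horner_mx_le A_sym eigA) => l ll.
have fl : f.[l] = c * (1 - p.[l]) - 1.
  by rewrite hornerD hornerN -[1]/(1%:P) hornerC hornerM hornerC pE.
clearbody f.
rewrite [f ^+ 2]expr2 !hornerM hornerD hornerX !hornerC fl -expr2.
rewrite ler_wpM2r//; first lra.
have -> : 9 * e ^+ 2 = (3 * e) ^+ 2 by ring.
rewrite -[leLHS]real_normK ?num_real// lerXn2r ?nnegrE//; first lra.
move: (pe l ll); rewrite !ler_norml => /andP[pl pr].
set q := p.[l] in pl pr *; move: (c) c0 cle cge => k k0 kle kge.
(* From [e <= 1/3]; then [|k - 1|] and [|k q|] are each at most [3/2 e], whose sum is [3 e]. *)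
have k32 : k <= 3 / 2 by nra.
have ke : k * e <= 3 / 2 * e by rewrite ler_pM2r.
have kq1 : k * q <= k * e by rewrite ler_pM2l.
have kq2 : k * - e <= k * q by rewrite ler_pM2l.
by apply/andP; split; lra.
Qed.

(* Shifting by [lmin] makes the quadratic part convex and leaves it unchanged on
   the sphere of radius [enorm x]. *)
Lemma sublinear_candidate (t : nat) : (1 <= t)%N ->
  exists y, [/\ y \in krylov A b t, enorm y <= enorm x &
    1 / 2 * dot (y - x) (A *m (y - x) - lmin *: (y - x)) -
      (lmin + lam) * dot x (y - x) <=
    4 * (lmax - lmin) / (t%:R - 1 / 2) ^+ 2 * enorm x ^+ 2].
Proof.
move=> t1; have [p [pt p1] pb] := fejer_residual t1 lmin_le lam_ge0.
have pE l : (1 - p).[l] = 1 - p.[l] by rewrite hornerD hornerN -[1]/(1%:P) hornerC.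
have dotCx c : c * dot x x = dot x (horner_mx A c%:P *m x).
  by rewrite horner_mx_C mul_scalar_mx dotZr.
exists (x - horner_mx A p *m x); split.
- exact: mem_krylov_residual x_stat pt p1.
- rewrite -horner_mx_1B enorm_le dot_horner_mx2// -[leRHS]mul1r dotCx.
  apply: (dot_horner_mx_le A_sym eigA) => l /pb[/andP[p0 p_le1] _].
  by rewrite hornerM pE hornerC; nra.
- rewrite enorm_sqr dotCx addrAC subrr sub0r.
  have -> : 1 / 2 * dot (- (horner_mx A p *m x)) (A *m - (horner_mx A p *m x) -
       lmin *: - (horner_mx A p *m x)) -
       (lmin + lam) * dot x (- (horner_mx A p *m x)) =
     dot x (horner_mx A ((1 / 2)%:P * (p * (('X - lmin%:P) * p)) +
       (lmin + lam)%:P * p) *m x).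
    rewrite rmorphD mulmxDl /= !horner_mx_CM [in RHS]dotDr !(dotZr _ x).
    rewrite -dot_horner_mx2//.
    by rewrite horner_mx_XsubCM mulmxN scalerN !dot_lin; ring.
  apply: (dot_horner_mx_le A_sym eigA) => l /pb[_].
  rewrite hornerD !hornerM hornerXsubC !hornerC.
  by apply: le_trans; rewrite le_eqVlt; apply/orP/or_introl/eqP; field.
Qed.

Lemma sphere_gap y : enorm y = enorm x ->
  cubic A b rho y - cubic A b rho x =
  1 / 2 * dot (y - x) (A *m (y - x) - lmin *: (y - x)) -
      (lmin + lam) * dot x (y - x).
Proof.
move=> yx; rewrite cubic_gap yx subrr mulr0 addr0.
have := enorm_sqr y; rewrite yx enorm_sqr.
by rewrite !dot_lin (dotC y x) => <-; field.
Qed.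

(** The right side exceeds the left by [lmin / 2 (|x|^2 - |y|^2) + rho / 3 (|x|^3 - |y|^3)]. *)
Lemma ball_gap y : 0 <= lmin -> enorm y <= enorm x ->
  cubic A b rho y - cubic A b rho x <=
  1 / 2 * dot (y - x) (A *m (y - x) - lmin *: (y - x)) -
      (lmin + lam) * dot x (y - x).
Proof.
move=> l0 yx; rewrite cubic_gap.
have y3 : enorm y ^+ 3 <= enorm x ^+ 3 by rewrite lerXn2r ?nnegrE ?enorm_ge0.
have y2 : dot y y <= dot x x by rewrite -enorm_le.
have h1 : 0 <= rho * (enorm x ^+ 3 - enorm y ^+ 3) by rewrite mulr_ge0// subr_ge0.
have h2 : 0 <= lmin * (dot x x - dot y y) by rewrite mulr_ge0// subr_ge0.
rewrite !dot_lin (dotC y x); lra.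
Qed.

Lemma indefinite_candidate (t : nat) u
    (L := ln (4 * dot b b / dot u b ^+ 2)) : (1 <= t)%N ->
  unit_eigenvector A lmin u -> dot u b != 0 ->
  exists2 y, y \in krylov A b t & cubic A b rho y - cubic A b rho x <=
    (lmax - lmin) * enorm x ^+ 2 / (t%:R - 1 / 2) ^+ 2 * (4 + 1 / 8 * L ^+ 2).
Proof.
move=> t1 ue ub.
have tR : 1 <= t%:R :> R by rewrite ler1n.
have [y [yK yx yle]] := sublinear_candidate t1.
have [z [zK z0 zle]] := approx_eigenvector A_sym eigA t1 lmin_le ue ub.
rewrite -/L in zle.
pose C (v : 'cV[R]_n.+1) := A *m v - lmin *: v.
(* The vector passed is the gradient at [y] of the shifted quadratic, so the move along [z] costs
   only its second-order term. *)
have [al [alx alv alz]] := boundary_step (C (y - x) - (lmin + lam) *: x) yx z0.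
exists (y + al *: z); first by rewrite rpredD// memvZ.
rewrite (sphere_gap alx).
have zz : 0 < dot z z by rewrite dot_gt0.
have CE : dot (y - x) (A *m z - lmin *: z) = dot z (C (y - x)).
  rewrite /C [y - x]lock !dot_lin; congr (_ - _ * _); last exact: dotC.
  exact: dot_mulmxC.
have -> : 1 / 2 * dot (y + al *: z - x)
     (A *m (y + al *: z - x) - lmin *: (y + al *: z - x)) -
   (lmin + lam) * dot x (y + al *: z - x) =
   (1 / 2 * dot (y - x) (A *m (y - x) - lmin *: (y - x)) -
      (lmin + lam) * dot x (y - x)) +
   al * dot z (C (y - x) - (lmin + lam) *: x) +
   1 / 2 * (al ^+ 2 * dot z (A *m z - lmin *: z)).
  have -> : y + al *: z - x = (y - x) + al *: z by rewrite addrAC.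
  move: CE; rewrite /C; move: (y - x) => v CE.
  have -> : A *m (v + al *: z) - lmin *: (v + al *: z) =
     (A *m v - lmin *: v) + al *: (A *m z - lmin *: z).
    rewrite mulmxDr -scalemxAr !scalerDr scalerN opprD !scalerA (mulrC al).
    by rewrite addrACA.
  move: CE; move: (A *m z - _) (A *m v - _) => Cz Cv CE.
  by rewrite !dot_lin CE (dotC z x); field.
have alCz : al ^+ 2 * dot z (A *m z - lmin *: z) <=
    (lmax - lmin) * (L / (4 * (t%:R - 1 / 2))) ^+ 2 * (4 * enorm x ^+ 2).
  apply: le_trans (ler_wpM2l (sqr_ge0 al) zle) _.
  rewrite mulrCA ler_wpM2l// mulr_ge0 ?sqr_ge0// subr_ge0//.
(* The curvature bound with [|al z|^2 <= 4 |x|^2] gives the coefficient [1/2 * 4 / 16 = 1/8] of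
   [L^2]. *)
apply: (@le_trans _ _ (4 * (lmax - lmin) / (t%:R - 1 / 2) ^+ 2 * enorm x ^+ 2 +
  1 / 2 * ((lmax - lmin) * (L / (4 * (t%:R - 1 / 2))) ^+ 2 * (4 * enorm x ^+ 2)))).
  by move: yle alv alCz; lra.
rewrite le_eqVlt; apply/orP/or_introl/eqP; field.
by lra.
Qed.

End Gap.


Theorem corollary4 (R : realType) (d : nat) (A : 'M[R]_d) (b : 'cV[R]_d)
    (rho lmin lmax : R) (umin xstar : 'cV[R]_d)
    (A_sym : A^T = A) (rho_ge0 : 0 <= rho)
    (lmin_eig : smallest_eigenvalue A lmin)
    (lmax_eig : largest_eigenvalue A lmax)
    (umin_eig : unit_eigenvector A lmin umin)
    (xstar_min : minimizer_on (cubic A b rho) setT xstar) :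
  forall (t : nat) (s : 'cV[R]_d), (1 <= t)%N ->
    minimizer_on (cubic A b rho) [set` krylov A b t] s ->
    cubic A b rho s - cubic A b rho xstar <=
      36 * (cubic A b rho 0 - cubic A b rho xstar) *
        linear_rate lmin lmax rho (enorm xstar) t
    /\
    ((cubic A b rho s - cubic A b rho xstar)%:E <=
      sublinear_bound b umin lmin lmax (enorm xstar) t)%E.
Proof.
move=> t s t1 [_ s_min].
case: d A b umin xstar A_sym lmin_eig lmax_eig umin_eig xstar_min s s_min
  => [|n] A b umin xstar A_sym [lminA lmin_le] [lmaxA lmax_ge] umin_eig
     xstar_min s s_min.
  (* In dimension 0 there is no unit vector. *)
  case: umin_eig => _; rewrite [umin]flatmx0 => /eqP.
  have -> : enorm (0 : 'cV[R]_0) = 0 by apply/eqP; rewrite enorm_eq0.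
  by rewrite eq_sym oner_eq0.
have eigA l : eigenvalue A l -> lmin <= l <= lmax.
  by move=> lA; rewrite lmin_le ?lmax_ge.
have ll : lmin <= lmax := lmax_ge _ lminA.
have x_stat := minimizer_stationary A_sym rho_ge0 xstar_min.
have l0 := minimizer_curvature A_sym rho_ge0 xstar_min umin_eig.
have s_le y c : y \in krylov A b t -> cubic A b rho y - cubic A b rho xstar <= c ->
    cubic A b rho s - cubic A b rho xstar <= c.
  by move=> yK; apply: le_trans; rewrite lerD2r s_min.
have F0 : 0 <= cubic A b rho 0 - cubic A b rho xstar.
  by rewrite subr_ge0; case: xstar_min => _; apply.
split.
  pose e := 2 * expR (- (2 * t%:R *
    Num.sqrt ((lmin + rho * enorm xstar) / (lmax + rho * enorm xstar)))).
  have -> : 36 * (cubic A b rho 0 - cubic A b rho xstar) *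
      linear_rate lmin lmax rho (enorm xstar) t =
      9 * e ^+ 2 * (cubic A b rho 0 - cubic A b rho xstar).
    rewrite /linear_rate /e exprMn -expRM_natr.
    rewrite (_ : - (2 * _ * _) * _ = - (4 * t%:R * Num.sqrt
      ((lmin + rho * enorm xstar) / (lmax + rho * enorm xstar)))); last by ring.
    by ring.
  have e0 : 0 < e by rewrite mulr_gt0 ?expR_gt0.
  have [e1|e1] := leP (3 * e) 1; last first.
    (* Here [9 e^2 > 1], so the gap at 0 is already within the bound. *)
    apply: (@s_le 0); first exact: mem0v.
    by rewrite ler_peMl//; nra.
  (* A vanishing numerator would give [e = 2], against [3 e <= 1]. *)
  have lp : 0 < lmin + rho * enorm xstar.
    rewrite lt0r l0 andbT; apply: contraTneq e1 => lE; rewrite -ltNge /e lE.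
    by rewrite mul0r sqrtr0 mulr0 oppr0 expR0; lra.
  have [y yK yle] := linear_candidate A_sym eigA x_stat ll t1 lp e1.
  apply: s_le yK (le_trans yle _).
  by rewrite ler_wpM2l ?mulr_ge0 ?sqr_ge0// (cubic0_gap A_sym).
rewrite /sublinear_bound; have [lneg|lpos] := ltP lmin 0; last first.
  rewrite /= lee_fin !mul0r addr0.
  have [y [yK yx yle]] := sublinear_candidate A_sym eigA x_stat l0 ll t1.
  apply: s_le yK (le_trans (ball_gap A_sym rho_ge0 x_stat lpos yx) _).
  apply: le_trans yle _; rewrite le_eqVlt; apply/orP/or_introl/eqP.
  by ring.
case: eqP => [_|/eqP ub] /=; first by rewrite leey.
rewrite lee_fin (enorm_sqr b).
have [y yK yle] := indefinite_candidate A_sym eigA x_stat l0 ll t1 umin_eig ub.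
exact: s_le yK yle.
Qed.
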